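(* Let $g=4k$ or $g=4k+2$ with $k\ge1$, and let $\overline{M_m}$, $0\le m\le\frac{g}{2}$, be the matrices defined in the context, regarded as spin structures of $\Sigma_g$. (1) For $1\le m\le \frac{g}{2}$, the group $$\mathfrak{G}_m:=\langle \sigma_i \mid 1\le i\le 2g+1,\ i\ne g+1+2m\rangle\cong \mathfrak{S}_{g+1+2m}\times\mathfrak{S}_{g+1-2m}$$ is a subgroup of the isotropy group at $\overline{M_m}$ for the $\mathfrak{S}_{2g+2}$ action. (2) The group $$\mathfrak{G}_0:=\langle \sigma_i,\tau \mid 1\le i\le 2g+1,\ i\ne g+1\rangle$$ is a subgroup of the isotropy group at $\overline{M_0}$, where $\tau$ is the product of the transpositions $(i,2g+3-i)$, $1\le i\le g+1$, i.e. $\tau=(1,2g+2)(2,2g+1)(3,2g)\cdots(g+1,g+2)$.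
   Context: $\Sigma_g$ is a compact connected oriented surface of genus $g$, and $\alpha_1,\dots,\alpha_g,\beta_1,\dots,\beta_g$ is a symplectic basis of $H_1(\Sigma_g,\mathbb{Z}/2)$, i.e. $\alpha_i\cdot\beta_j=\delta_{ij}$, $\alpha_i\cdot\alpha_j=\beta_i\cdot\beta_j=0$ for the mod 2 intersection number. A spin structure is a map $c:H_1(\Sigma_g,\mathbb{Z}/2)\to\mathbb{Z}/2$ with $c(x+y)=c(x)+c(y)+x\cdot y$ for all $x,y$; $\mathcal{C}$ is the set of spin structures. The corresponding matrix of $c$ is the $2\times g$ matrix $M$ over $\mathbb{Z}/2$ whose $i$-th column is $\begin{pmatrix}c(\alpha_i)\\c(\beta_i)\end{pmatrix}$; it determines $c$, every $2\times g$ matrix over $\mathbb{Z}/2$ arises, and spin structures are identified with their matrices. For $\gamma\in H_1(\Sigma_g,\mathbb{Z}/2)$ let $T_\gamma(x)=x+(x\cdot\gamma)\gamma$, an element of the group $Sp_{2g}(\mathbb{Z}/2)$ of automorphisms preserving the intersection number. Let $\sigma_i=(i,i+1)\in\mathfrak{S}_{2g+2}$, $1\le i\le 2g+1$, where $\mathfrak{S}_n$ is the symmetric group. The group $\mathfrak{S}_{2g+2}$ acts through the homomorphism $\iota:\mathfrak{S}_{2g+2}\to Sp_{2g}(\mathbb{Z}/2)$ determined by $\iota(\sigma_1)=T_{\beta_1}$, $\iota(\sigma_{2g+1})=T_{\beta_g}$, $\iota(\sigma_{2i})=T_{\alpha_i}$ ($1\le i\le g$), $\iota(\sigma_{2j+1})=T_{\beta_j+\beta_{j+1}}$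 ($1\le j\le g-1$). It acts on $\mathcal{C}$ from the right by $c\circ\sigma:=c\circ\iota(\sigma)$. The isotropy group at $c$ is $\{\sigma\in\mathfrak{S}_{2g+2}: c\circ\sigma=c\}$. For $i\ge1$, $A_i$ is the $2\times(2i-1)$ matrix over $\mathbb{Z}/2$ whose odd-numbered columns are $\begin{pmatrix}1\\1\end{pmatrix}$ and whose even-numbered columns are $\begin{pmatrix}1\\0\end{pmatrix}$. The $2\times g$ matrices $\overline{M_m}$ are defined by horizontal concatenation of blocks: Case $g=4k$ ($0\le m\le 2k$): $\overline{M_{2i}}=\begin{pmatrix}A_{k+i}&\begin{matrix}1&1\\0&0\end{matrix}&A_{k-i}\end{pmatrix}$ for $0\le i\le k-1$; $\overline{M_{2i+1}}=\begin{pmatrix}A_{k+i+1}&A_{k-i}\end{pmatrix}$ for $0\le i\le k-1$; $\overline{M_{2k}}=\begin{pmatrix}A_{2k}&\begin{matrix}1\\0\end{matrix}\end{pmatrix}$. Case $g=4k+2$ ($0\le m\le 2k+1$): $\overline{M_{2i}}=\begin{pmatrix}A_{k+i+1}&A_{k-i+1}\end{pmatrix}$ for $0\le i\le k$; $\overline{M_{2i+1}}=\begin{pmatrix}A_{k+i+1}&\begin{matrix}1&1\\0&0\end{matrix}&A_{k-i}\end{pmatrix}$ for $0\le i\le k-1$; $\overline{M_{2k+1}}=\begin{pmatrix}A_{2k+1}&\begin{matrix}1\\0\end{matrix}\end{pmatrix}$. The paper denotes the group $\langle \sigma_i,\tau \mid i\ne g+1\rangle$ by $\mathfrak{S}_{g+1}\overleftrightarrow{\times}\mathfrak{S}_{g+1}$.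 *)

(* Defs.v *)
From HB Require Import structures.
From mathcomp Require Import all_boot all_order all_algebra all_fingroup.
From mathcomp Require Import zify ring.

Set Implicit Arguments.
Unset Strict Implicit.
Unset Printing Implicit Defensive.

Import GRing.Theory.
Local Open Scope ring_scope.

(* H_1(Sigma_g, Z/2) with its mod 2 intersection number and a chosen symplectic
   basis.  These data are all that enters the theory of mod 2 spin structures,
   so the surface itself is not modelled.  Indices start at 0: alpha_{i+1} and
   beta_{i+1} are [sh_alpha i] and [sh_beta i] for i : 'I_g. *)
Record surface_homology (g : nat) := SurfaceHomology {
  sh_carrier :> finLmodType 'F_2;
  sh_dot : sh_carrier -> sh_carrier -> 'F_2;
  sh_alpha : 'I_g -> sh_carrier;
  sh_beta : 'I_g -> sh_carrier;
  sh_dot_linearl : forall a x y z,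
    sh_dot (a *: x + y) z = a * sh_dot x z + sh_dot y z;
  sh_dotC : forall x y, sh_dot x y = sh_dot y x;
  sh_alphaP : forall i j, sh_dot (sh_alpha i) (sh_alpha j) = 0;
  sh_betaP : forall i j, sh_dot (sh_beta i) (sh_beta j) = 0;
  sh_alpha_betaP : forall i j, sh_dot (sh_alpha i) (sh_beta j) = (i == j)%:R;
  sh_basisP : forall x, exists! ab : {ffun 'I_g -> 'F_2} * {ffun 'I_g -> 'F_2},
    x = \sum_i ab.1 i *: sh_alpha i + \sum_i ab.2 i *: sh_beta i
}.

Arguments sh_dot {g s}.
Arguments sh_alpha {g s}.
Arguments sh_beta {g s}.

Section SpinStructures.

Context {g : nat} {H : surface_homology g}.

Definition is_spin (c : H -> 'F_2) : Prop :=
  forall x y, c (x + y) = c x + c y + sh_dot x y.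

Definition spin_matrix (c : H -> 'F_2) : 'M['F_2]_(2, g) :=
  \matrix_(r, i) if r == ord0 then c (sh_alpha i) else c (sh_beta i).

Definition transvection (gamma x : H) : H := x + sh_dot x gamma *: gamma.

End SpinStructures.

Section Sp.

Context {g : nat} (H : surface_homology g).

Definition Sp : {set {perm H}} := [set p : {perm H} |
  [forall a : 'F_2, forall x : H, forall y : H,
     p (a *: x + y) == a *: p x + p y] &&
  [forall x : H, forall y : H, sh_dot (p x) (p y) == sh_dot x y]].

Lemma Sp_group_set : group_set Sp.
Proof.
apply/group_setP; split=> [|p q].
  rewrite inE; apply/andP; split.
    by do 3!apply/forallP=> ?; rewrite !perm1.
  by do 2!apply/forallP=> ?; rewrite !perm1.
rewrite !inE => /andP[/forallP pL /'forall_forallP pD].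
move=> /andP[/forallP qL /'forall_forallP qD]; apply/andP; split.
  apply/forallP=> a; apply/forallP=> x; apply/forallP=> y; rewrite !permM.
  have /forallP/(_ x)/forallP/(_ y)/eqP-> := pL a.
  by have /forallP/(_ (p x))/forallP/(_ (p y)) := qL a.
apply/forallP=> x; apply/forallP=> y; rewrite !permM.
by rewrite (eqP (qD _ _)) (eqP (pD _ _)).
Qed.

Canonical Sp_group := Group Sp_group_set.

End Sp.

(* The transposition (i, i+1) of {1, ..., 2g+2}, for 1 <= i <= 2g+1; the point
   p of {1, ..., 2g+2} is the ordinal p - 1. *)
Definition sigma (g i : nat) : 'S_(g.*2.+2) := tperm (inord i.-1) (inord i).

(* tau = (1, 2g+2)(2, 2g+1)...(g+1, g+2), with the same shift of the points. *)
Definition tau (g : nat) : 'S_(g.*2.+2) :=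
  (\prod_(i < g.+1) tperm (inord i) (inord (g.*2.+1 - i)))%g.

Definition frakG (g m : nat) : {set 'S_(g.*2.+2)} :=
  <<[set sigma g i | i : 'I_(g.*2.+2) & (1 <= i)%N && (i != g + 1 + 2 * m :> nat)%N]>>%g.

Definition frakG0 (g : nat) : {set 'S_(g.*2.+2)} :=
  <<tau g |: [set sigma g i | i : 'I_(g.*2.+2) & (1 <= i)%N && (i != g + 1 :> nat)%N]>>%g.

Section Action.

Context {g : nat} {H : surface_homology g}.

(* The product of permutations is left-to-right in both groups, so such a
   morphism is also one for right-to-left composition on both sides.  The
   ordinal i stands for the 1-based index i.+1. *)
Definition is_iota (iota : {morphism [set: 'S_(g.*2.+2)] >-> {perm H}}) : Prop :=
  [/\ (iota @* [set: 'S_(g.*2.+2)] \subset Sp H)%g,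
      forall i : 'I_g, i = 0%N :> nat ->
        iota (sigma g 1) =1 transvection (sh_beta i),
      forall i : 'I_g, i.+1 = g ->
        iota (sigma g (2 * g + 1)) =1 transvection (sh_beta i),
      forall i : 'I_g,
        iota (sigma g (2 * i.+1)) =1 transvection (sh_alpha i)
    & forall i j : 'I_g, j = i.+1 :> nat ->
        iota (sigma g (2 * i.+1 + 1)) =1 transvection (sh_beta i + sh_beta j)].

Context (iota : {morphism [set: 'S_(g.*2.+2)] >-> {perm H}}) (c : H -> 'F_2).

Definition spin_act (s : 'S_(g.*2.+2)) : H -> 'F_2 := c \o iota s.

Definition isotropy : {set 'S_(g.*2.+2)} :=
  [set s | [forall x, spin_act s x == c x]].

Lemma isotropy_group_set : group_set isotropy.
Proof.
apply/group_setP; split=> [|s t].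
  by rewrite inE; apply/forallP=> x; rewrite /spin_act /= morph1 perm1.
rewrite !inE => /forallP sP /forallP tP; apply/forallP=> x.
rewrite /spin_act /= morphM ?inE // permM.
by have /eqP := tP (iota s x); rewrite /spin_act /= => ->; apply: sP.
Qed.

Canonical isotropy_group := Group isotropy_group_set.

End Action.

Definition col11 : 'cV['F_2]_2 := const_mx 1.
Definition col10 : 'cV['F_2]_2 := \col_r (r == ord0)%:R.

(* Matrices with two rows are written as their sequences of columns, so that
   horizontal concatenation is [++]. *)
Definition Ablock (i : nat) : seq 'cV['F_2]_2 :=
  mkseq (fun j => if odd j.+1 then col11 else col10) (2 * i - 1).

Definition Mbar_cols4k (k m : nat) : seq 'cV['F_2]_2 :=
  let i := m./2 in
  if m == (2 * k)%N then Ablock (2 * k) ++ [:: col10]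
  else if odd m then Ablock (k + i + 1) ++ Ablock (k - i)
  else Ablock (k + i) ++ [:: col10; col10] ++ Ablock (k - i).

Definition Mbar_cols4k2 (k m : nat) : seq 'cV['F_2]_2 :=
  let i := m./2 in
  if m == (2 * k + 1)%N then Ablock (2 * k + 1) ++ [:: col10]
  else if odd m then Ablock (k + i + 1) ++ [:: col10; col10] ++ Ablock (k - i)
  else Ablock (k + i + 1) ++ Ablock (k - i + 1).

(* Only meant for g = 4k or g = 4k + 2. *)
Definition Mbar_cols (g m : nat) : seq 'cV['F_2]_2 :=
  if (g %% 4 == 0)%N then Mbar_cols4k (g %/ 4) m else Mbar_cols4k2 (g %/ 4) m.

Definition Mbar (g m : nat) : 'M['F_2]_(2, g) :=
  \matrix_(r, j) nth 0 (Mbar_cols g m) j r 0.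

Lemma size_Mbar_cols (g m : nat) :
  (3 < g)%N -> ~~ odd g -> (m <= g./2)%N -> size (Mbar_cols g m) = g.
Proof.
move=> g4 go mg; have gE := divn_eq g 4; have gm := ltn_pmod g (isT : 0 < 4)%N.
have g2 := odd_double_half g; have m2 := odd_double_half m.
rewrite -!muln2 in g2 m2; rewrite (negPf go) in g2.
rewrite /Mbar_cols /Mbar_cols4k /Mbar_cols4k2.
have [g0|g0] := eqVneq (g %% 4)%N 0%N.
  case: eqP => [mE|mE]; first by rewrite size_cat size_mkseq /=; lia.
  by case: (odd m) m2 => m2; rewrite !size_cat !size_mkseq /=; lia.
have {}g0 : (g %% 4 = 2)%N by lia.
case: eqP => [mE|mE]; first by rewrite size_cat size_mkseq /=; lia.
by case: (odd m) m2 => m2; rewrite !size_cat !size_mkseq /=; lia.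
Qed.

Lemma surface_homology_exists (g : nat) : inhabited (surface_homology g).
Proof.
pose V : finLmodType 'F_2 := 'M['F_2]_(2, g).
pose r0 : 'I_2 := ord0; pose r1 : 'I_2 := ord_max.
pose dot (x y : V) : 'F_2 := \sum_i (x r0 i * y r1 i + x r1 i * y r0 i).
pose al (i : 'I_g) : V := delta_mx r0 i; pose be (i : 'I_g) : V := delta_mx r1 i.
have rowE (a b : {ffun 'I_g -> 'F_2}) r j :
    (\sum_i a i *: al i + \sum_i b i *: be i : V) r j = if r == r0 then a j else b j.
  rewrite mxE !summxE (bigD1 j) //= big1 => [|l lj]; last first.
    by rewrite !mxE [j == l]eq_sym (negPf lj) andbF mulr0.
  rewrite [X in _ + X](bigD1 j) //= [X in _ + (_ + X)]big1 => [|l lj]; last first.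
    by rewrite !mxE [j == l]eq_sym (negPf lj) andbF mulr0.
  rewrite !mxE eqxx !andbT; case: r => [[|[|//]] ?] /=.
    by rewrite mulr1 mulr0 !addr0.
  by rewrite mulr1 mulr0 !addr0 add0r.
apply: inhabits; apply: (@SurfaceHomology g V dot al be).
- move=> a x y z; rewrite /dot mulr_sumr -big_split; apply: eq_bigr => i _ /=.
  by rewrite !mxE; ring.
- by move=> x y; apply: eq_bigr => i _; ring.
- by move=> i j; rewrite /dot big1 // => l _; rewrite !mxE /= !mulr0 ?mul0r addr0.
- by move=> i j; rewrite /dot big1 // => l _; rewrite !mxE /= !mulr0 ?mul0r addr0.
- move=> i j; rewrite /dot (bigD1 i) //= big1 => [|l li]; rewrite !mxE /=.
    by rewrite !eqxx mul1r mul0r !addr0.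
  by rewrite (negPf li) !mul0r addr0.
- move=> x; exists ([ffun i => x r0 i], [ffun i => x r1 i]); split=> [|[a b] /= ->].
    apply/matrixP=> r j; rewrite rowE !ffunE; case: eqP => [-> //|rN].
    congr (x _ j); apply: val_inj; case: r rN => [[|[|r]] rP] rN //=.
    by case: rN; apply: val_inj.
  by congr pair; apply/ffunP=> j; rewrite ffunE rowE.
Qed.

(* The hypotheses "[is_iota iota]" and "[is_spin c], [spin_matrix c = M]" are
   satisfiable for every H and M. *)
Section Existence.

Context {g : nat} (H : surface_homology g).
Implicit Types (x y z : H) (a b : 'I_g -> H) (s t : 'S_(g.*2.+2)).

Lemma addF2 (e : 'F_2) : e + e = 0.
Proof. exact/addrr_pchar2/pchar_Fp. Qed.

Lemma sh_addxx x : x + x = 0.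
Proof. by rewrite -{1 2}[x]scale1r -scalerDl addF2 scale0r. Qed.

Lemma sh_addK x y : x + y + y = x.
Proof. by rewrite -addrA sh_addxx addr0. Qed.

Lemma sh_dotDl x y z : sh_dot (x + y) z = sh_dot x z + sh_dot y z.
Proof. by have := sh_dot_linearl 1 x y z; rewrite scale1r mul1r. Qed.

Lemma sh_dotDr x y z : sh_dot z (x + y) = sh_dot z x + sh_dot z y.
Proof. by rewrite !(sh_dotC z) sh_dotDl. Qed.

Lemma sh_dot0l z : sh_dot 0 z = 0.
Proof. by apply: (addrI (sh_dot 0 z)); rewrite -sh_dotDl !addr0. Qed.

Lemma sh_dotZl e x z : sh_dot (e *: x) z = e * sh_dot x z.
Proof. by rewrite -[e *: x]addr0 sh_dot_linearl sh_dot0l addr0. Qed.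

Lemma sh_dot_suml (I : finType) (P : pred I) (f : I -> H) z :
  sh_dot (\sum_(i | P i) f i) z = \sum_(i | P i) sh_dot (f i) z.
Proof.
by apply: (big_morph (fun x => sh_dot x z) (fun x y => sh_dotDl x y z) (sh_dot0l z)).
Qed.

Lemma F2_cases (e : 'F_2) : e = 0 \/ e = 1.
Proof. by case: e => [[|[|//]] ?]; [left | right]; apply: val_inj. Qed.

Lemma sh_ind (P : H -> Prop) : P 0 -> (forall x y, P x -> P y -> P (x + y)) ->
  (forall i, P (sh_alpha i)) -> (forall i, P (sh_beta i)) -> forall x, P x.
Proof.
move=> P0 PD Pa Pb x; have [ab [-> _]] := sh_basisP x.
have PZ e y : P y -> P (e *: y).
  by move=> Py; case: (F2_cases e) => ->; rewrite ?scale0r ?scale1r.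
by apply: (PD); apply: (big_ind P) => // i _; apply: PZ.
Qed.

(* The linear map with prescribed values on the basis. *)
Definition sh_extend a b x : H :=
  \sum_i (sh_dot x (sh_beta i) *: a i + sh_dot x (sh_alpha i) *: b i).

Lemma sh_extendD a b x y :
  sh_extend a b (x + y) = sh_extend a b x + sh_extend a b y.
Proof.
rewrite -big_split; apply: eq_bigr => i _ /=.
by rewrite !sh_dotDl !scalerDl addrACA.
Qed.

Lemma sh_extend0 a b : sh_extend a b 0 = 0.
Proof. by apply: (addrI (sh_extend a b 0)); rewrite -sh_extendD !addr0. Qed.

Lemma sh_extendZ a b e x : sh_extend a b (e *: x) = e *: sh_extend a b x.
Proof.
by case: (F2_cases e) => ->; rewrite ?scale0r ?scale1r ?sh_extend0.
Qed.

Lemma sh_extend_sum a b (I : finType) (P : pred I) (f : I -> H) :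
  sh_extend a b (\sum_(i | P i) f i) = \sum_(i | P i) sh_extend a b (f i).
Proof. exact: (big_morph _ (sh_extendD a b) (sh_extend0 a b)). Qed.

Lemma sh_extend_alpha a b i : sh_extend a b (sh_alpha i) = a i.
Proof.
rewrite /sh_extend (bigD1 i) //= big1 => [|j ji]; last first.
  by rewrite sh_alpha_betaP sh_alphaP eq_sym (negPf ji) !scale0r addr0.
by rewrite sh_alpha_betaP sh_alphaP eqxx scale1r scale0r !addr0.
Qed.

Lemma sh_extend_beta a b i : sh_extend a b (sh_beta i) = b i.
Proof.
rewrite /sh_extend (bigD1 i) //= big1 => [|j ji]; last first.
  by rewrite sh_betaP sh_dotC sh_alpha_betaP (negPf ji) !scale0r addr0.
by rewrite sh_betaP sh_dotC sh_alpha_betaP eqxx scale1r scale0r add0r addr0.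
Qed.

(* Partial sums of the chain beta_1, alpha_1, beta_1 + beta_2, alpha_2, ... *)
Definition chain_sum a b (j : nat) : H :=
  \sum_(l < g | (l.*2.+2 <= j)%N) a l + \sum_(l < g | uphalf j == l.+1) b l.

Notation u := (chain_sum sh_alpha sh_beta).

Lemma sum_uphalf (V : nmodType) (f : 'I_g -> V) j (i : 'I_g) :
  uphalf j = i.+1 -> \sum_(l < g | uphalf j == l.+1) f l = f i.
Proof.
by move=> ->; rewrite (big_pred1 i) // => l; rewrite eqSS eq_sym val_eqE.
Qed.

Lemma sum_uphalf0 (V : nmodType) (f : 'I_g -> V) j :
  (j == 0%N) || (g.*2 < j)%N -> \sum_(l < g | uphalf j == l.+1) f l = 0.
Proof.
move=> jP; rewrite big_pred0 // => l; apply/negbTE/negP=> /eqP.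
by move: jP (ltn_ord l); rewrite uphalf_half; have := odd_double_half j; lia.
Qed.

Lemma chain_sum0 a b : chain_sum a b 0 = 0.
Proof. by rewrite /chain_sum sum_uphalf0 ?addr0 // big_pred0. Qed.

Lemma chain_sum_odd a b (i : 'I_g) :
  chain_sum a b i.*2.+1 = \sum_(l < g | (l < i)%N) a l + b i.
Proof.
rewrite /chain_sum (@sum_uphalf _ _ _ i); last by lia.
by congr (_ + _); apply: eq_bigl => l; lia.
Qed.

Lemma chain_sum_even a b (i : 'I_g) :
  chain_sum a b i.*2.+2 = \sum_(l < g | (l < i)%N) a l + a i + b i.
Proof.
rewrite /chain_sum (@sum_uphalf _ _ _ i); last by lia.
rewrite (bigD1 i) /=; last by lia.
rewrite [a i + _]addrC; congr (_ + _ + _); apply: eq_bigl => l.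
by rewrite -val_eqE /=; lia.
Qed.

Lemma chain_sum_last a b : chain_sum a b g.*2.+1 = \sum_(l < g) a l.
Proof.
rewrite /chain_sum sum_uphalf0 ?addr0; last by lia.
by apply: eq_bigl => l; have := ltn_ord l; lia.
Qed.

Lemma chain_indexP j : (j < g.*2.+2)%N ->
  [\/ j = 0%N, j = g.*2.+1, exists i : 'I_g, j = i.*2.+1
    | exists i : 'I_g, j = i.*2.+2].
Proof.
move=> jg; have := odd_double_half j; case: (posnP j) => [->|j0]; first by constructor 1.
case: (eqVneq j g.*2.+1) => [->|jN]; first by constructor 2.
case: (boolP (odd j)) => jo jE.
  have ig : (j./2 < g)%N by lia.
  by constructor 3; exists (Ordinal ig) => /=; lia.
have ig : (j./2.-1 < g)%N by lia.
by constructor 4; exists (Ordinal ig) => /=; lia.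
Qed.

Lemma sh_ind_chain (P : H -> Prop) :
  (forall x y, P x -> P y -> P (x + y)) ->
  (forall j, (j < g.*2.+2)%N -> P (u j)) -> forall x, P x.
Proof.
move=> PD Pu; have P0 : P 0 by rewrite -(chain_sum0 sh_alpha sh_beta); apply: Pu.
have Pa i : P (sh_alpha i).
  have -> : sh_alpha i = u i.*2.+2 + u i.*2.+1.
    rewrite chain_sum_odd chain_sum_even [X in X + sh_beta i]addrC.
    by rewrite -[sh_alpha i + _ + _]addrA sh_addK.
  by apply: PD; apply: Pu; have := ltn_ord i; lia.
apply: sh_ind => // i.
have -> : sh_beta i = u i.*2.+1 + \sum_(l < g | (l < i)%N) sh_alpha l.
  by rewrite chain_sum_odd [X in X + _]addrC sh_addK.
apply: (PD); first by apply: Pu; have := ltn_ord i; lia.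
by apply: (big_ind P) => [||l _]; [apply: P0 | apply: PD | apply: Pa].
Qed.

Lemma sum_eqS (P : pred nat) (t : nat) : \sum_(l < g | P l) (t == l.+1)%:R =
  [&& 0 < t, t <= g & P t.-1]%N%:R :> 'F_2.
Proof.
case: (boolP (0 < t <= g)%N) => [/andP[t0 tg]|tN]; last first.
  rewrite andbA (negPf tN) big1 // => l _; case: eqP => // tl.
  by have := ltn_ord l; lia.
have ig : (t.-1 < g)%N by lia.
rewrite t0 tg /= big_mkcond (bigD1 (Ordinal ig)) //= big1 => [|l li]; last first.
  case: (P l) => //; case: eqP => // tl; case/eqP: li.
  by apply: val_inj => /=; lia.
by rewrite prednK // eqxx addr0; case: (P _).
Qed.

Lemma dot_u_alpha j (i : 'I_g) : sh_dot (u j) (sh_alpha i) = (uphalf j == i.+1)%:R.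
Proof.
rewrite sh_dotDl !sh_dot_suml big1 ?add0r => [|l _]; last exact: sh_alphaP.
transitivity (\sum_(l < g | uphalf j == l.+1) (l == i)%:R : 'F_2).
  by apply: eq_bigr => l _; rewrite sh_dotC sh_alpha_betaP eq_sym.
rewrite big_mkcond (bigD1 i) //= eqxx big1 ?addr0; first by case: eqP.
by move=> l /negPf->; case: ifP.
Qed.

Lemma dot_u_beta j (i : 'I_g) : sh_dot (u j) (sh_beta i) = (i.*2.+2 <= j)%N%:R.
Proof.
rewrite sh_dotDl !sh_dot_suml [X in _ + X]big1 ?addr0 => [|l _]; last exact: sh_betaP.
transitivity (\sum_(l < g | (l.*2.+2 <= j)%N) (l == i)%:R : 'F_2).
  by apply: eq_bigr => l _; rewrite sh_alpha_betaP.
rewrite big_mkcond (bigD1 i) //= eqxx big1 ?addr0; first by case: leqP.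
by move=> l /negPf->; case: ifP.
Qed.

Lemma dot_u p q : (p < g.*2.+2)%N -> (q < g.*2.+2)%N ->
  sh_dot (u p) (u q) = 1 + (p == q)%:R + (p == 0%N)%:R + (q == 0%N)%:R.
Proof.
move=> pg qg; rewrite {1}/chain_sum sh_dotDl !sh_dot_suml.
under eq_bigr do rewrite sh_dotC dot_u_alpha.
rewrite (sum_eqS (fun l => l.*2.+2 <= p)%N).
under eq_bigr do rewrite sh_dotC dot_u_beta.
have -> : \sum_(l < g | uphalf p == l.+1) (l.*2.+2 <= q)%N%:R =
    [&& 0 < uphalf p, uphalf p <= g & (uphalf p).-1.*2.+2 <= q]%N%:R :> 'F_2.
  rewrite -(sum_eqS (fun l => l.*2.+2 <= q)%N) big_mkcond [RHS]big_mkcond.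
  by apply: eq_bigr => l _; case: eqP; case: leqP.
rewrite !uphalf_half; have := odd_double_half p; have := odd_double_half q.
case: (boolP [&& _, _ & _]) => h1; case: (boolP [&& _, _ & _]) => h2;
  case: (eqVneq p q) => h3; case: (eqVneq p 0%N) => h4; case: (eqVneq q 0%N) => h5 => e1 e2;
  first [by apply/val_inj | exfalso; lia].
Qed.

Lemma sum_pairs (w : nat -> H) n :
  \sum_(l < n) (w l.*2.+1 + w l.*2.+2) = \sum_(1 <= j < n.*2.+1) w j.
Proof.
elim: n => [|n IHn]; first by rewrite big_ord0 big_geq.
rewrite big_ord_recr /= IHn doubleS [RHS]big_nat_recr //= [in RHS]big_nat_recr //=.
by rewrite addrA.
Qed.

Lemma chain_sumE a b (w : nat -> H) :
    \sum_(j < g.*2.+2) w j = 0 ->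
    (forall i : 'I_g, a i = w i.*2.+1 + w i.*2.+2) ->
    (forall i : 'I_g, b i = w i.*2.+1 + w 0%N + \sum_(l < g | (l < i)%N) a l) ->
  forall j, (j < g.*2.+2)%N -> chain_sum a b j = w j + w 0%N.
Proof.
move=> w0 aE bE j /chain_indexP[->|->|[i ->]|[i ->]].
- by rewrite chain_sum0 sh_addxx.
- rewrite chain_sum_last; have -> : \sum_(l < g) a l = \sum_(1 <= j < g.*2.+1) w j.
    transitivity (\sum_(l < g) (w l.*2.+1 + w l.*2.+2)); first exact: eq_bigr.
    exact: sum_pairs.
  apply: (addIr (w g.*2.+1 + w 0%N)); rewrite sh_addxx -[RHS]w0.
  rewrite -(big_mkord xpredT) [RHS]big_nat_recr //= [in RHS]big_ltn // [w 0%N + _]addrC -addrA.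
  by congr (_ + _); rewrite addrC.
- by rewrite chain_sum_odd bE addrC sh_addK.
- rewrite chain_sum_even bE [X in X + _]addrC addrACA sh_addxx addr0 aE.
  by rewrite addrCA !addrA sh_addxx add0r.
Qed.

Lemma sum_u : \sum_(j < g.*2.+2) u j = 0.
Proof.
rewrite -(big_mkord xpredT) big_nat_recr //= chain_sum_last.
rewrite big_ltn // chain_sum0 add0r.
suff -> : \sum_(1 <= i < g.*2.+1) u i = \sum_(l < g) sh_alpha l by rewrite sh_addxx.
transitivity (\sum_(l < g) (u l.*2.+1 + u l.*2.+2)).
  exact/esym/(sum_pairs u).
apply: eq_bigr => i _; rewrite chain_sum_odd chain_sum_even.
rewrite [_ + sh_alpha i]addrC -[sh_alpha i + _ + _]addrA.
by rewrite [LHS]addrC sh_addK.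
Qed.

Let w s (j : nat) : H := u (s (inord j)).
Let Fa s (i : 'I_g) : H := w s i.*2.+1 + w s i.*2.+2.
Let Fb s (i : 'I_g) : H :=
  w s i.*2.+1 + w s 0%N + \sum_(l < g | (l < i)%N) Fa s l.
Let F s : H -> H := sh_extend (Fa s) (Fb s).

Let FD s x y : F s (x + y) = F s x + F s y.
Proof. exact: sh_extendD. Qed.

Let Fu s j : (j < g.*2.+2)%N -> F s (u j) = w s j + w s 0%N.
Proof.
move=> jg; rewrite /F {1}/chain_sum sh_extendD !sh_extend_sum.
under eq_bigr do rewrite sh_extend_alpha.
under [X in _ + X]eq_bigr do rewrite sh_extend_beta.
apply: chain_sumE => //; rewrite -[RHS]sum_u [RHS](reindex_inj (@perm_inj _ s)).
by apply: eq_bigr => i _; rewrite /w inord_val.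
Qed.

Let FM s t x : F (s * t)%g x = F t (F s x).
Proof.
elim/sh_ind_chain: x => [x y xE yE|j jg]; first by rewrite !FD xE yE.
rewrite !Fu // FD !Fu ?ltn_ord // /w !inord_val !permM.
by rewrite [RHS]addrACA sh_addxx addr0.
Qed.

Let F1 x : F 1%g x = x.
Proof.
elim/sh_ind_chain: x => [x y xE yE|j jg]; first by rewrite !FD xE yE.
by rewrite Fu // /w !perm1 !inordK // chain_sum0 addr0.
Qed.

Let F_inj s : injective (F s).
Proof. by apply: (can_inj (g := F s^-1)) => x; rewrite -FM mulgV F1. Qed.

Let Fperm s : {perm H} := perm (@F_inj s).

Let FpermM : {in [set: 'S_(g.*2.+2)] &, {morph Fperm : s t / (s * t)%g}}.
Proof. by move=> s t _ _; apply/permP=> x; rewrite permM !permE FM. Qed.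

Let F_dot s x y : sh_dot (F s x) (F s y) = sh_dot x y.
Proof.
elim/sh_ind_chain: x => [x x' xE xE'|p pg].
  by rewrite FD !sh_dotDl xE xE'.
elim/sh_ind_chain: y => [y y' yE yE'|q qg].
  by rewrite FD !sh_dotDr yE yE'.
have D4 x1 x2 y1 y2 : sh_dot (x1 + x2) (y1 + y2) = sh_dot x1 y1 + sh_dot x1 y2 +
    (sh_dot x2 y1 + sh_dot x2 y2) :> 'F_2 by rewrite sh_dotDl !sh_dotDr.
rewrite !Fu // D4 /w !dot_u ?ltn_ord //.
have sE i j : (i < g.*2.+2)%N -> (j < g.*2.+2)%N ->
    (s (inord i) == s (inord j) :> nat) = (i == j).
  by move=> ig jg; rewrite val_eqE (inj_eq perm_inj) -val_eqE /= !inordK.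
rewrite !sE // [(0 == q)%N]eq_sym !eqxx.
by case: (p == q); case: (p == 0)%N; case: (q == 0)%N; case: (s (inord p) == 0 :> nat);
  case: (s (inord q) == 0 :> nat); case: (s (inord 0) == 0 :> nat); apply/val_inj.
Qed.

Let F_sigma i x : (0 < i < g.*2.+2)%N ->
  F (sigma g i) x = transvection (u i.-1 + u i) x.
Proof.
move=> /andP[i0 ig]; elim/sh_ind_chain: x => [x y xE yE|j jg].
  by rewrite FD xE yE /transvection sh_dotDl scalerDl addrACA.
have i1g : (i.-1 < g.*2.+2)%N by lia.
have wE m : (m < g.*2.+2)%N -> w (sigma g i) m =
    u m + ((m == i.-1)%:R + (m == i)%:R : 'F_2) *: (u i.-1 + u i).
  move=> mg; rewrite /w /sigma; case: tpermP => [/(congr1 val)|/(congr1 val)|].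
  - rewrite /= !inordK // => ->; rewrite eqxx ltn_eqF ?addr0 ?scale1r; last by lia.
    by rewrite addrA sh_addxx add0r.
  - rewrite /= !inordK // => ->; rewrite eqxx gtn_eqF ?add0r ?scale1r; last by lia.
    by rewrite [u i.-1 + _]addrC addrA sh_addxx add0r.
  move=> m1 m2; rewrite inordK //; case: eqP => [mE|_]; first by case: m1; rewrite mE.
  by case: eqP => [mE|_]; [case: m2; rewrite mE | rewrite addr0 scale0r addr0].
rewrite Fu // !wE // chain_sum0 add0r -addrA -scalerDl; congr (_ + _ *: _).
rewrite sh_dotDr !dot_u // [(0 == i)%N]eq_sym [(0 == i.-1)%N]eq_sym.
by case: (j == i.-1); case: (j == i); case: (i.-1 == 0)%N; case: (i == 0)%N;
  case: (j == 0)%N; apply/val_inj.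
Qed.

Lemma iota_exists :
  exists iota : {morphism [set: 'S_(g.*2.+2)] >-> {perm H}}, is_iota iota.
Proof.
exists (Morphism FpermM); split=> [|i i0 x|i ig x|i x|i j ji x] /=.
- apply/subsetP=> p /morphimP[s _ _ ->] /=; rewrite inE; apply/andP; split.
    do 3!apply/forallP=> ?; rewrite !permE /F sh_extendD sh_extendZ.
    exact: eqxx.
  by do 2!apply/forallP=> ?; rewrite !permE F_dot.
- rewrite permE F_sigma ?ltnS // chain_sum0 add0r.
  have -> : u 1 = u i.*2.+1 by rewrite i0.
  by rewrite chain_sum_odd big_pred0 ?add0r // => l; rewrite i0.
- rewrite permE F_sigma; last by lia.
  have -> : (2 * g + 1).-1 = i.*2.+2 by lia.
  have -> : (2 * g + 1 = g.*2.+1)%N by lia.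
  rewrite chain_sum_even chain_sum_last.
  have -> : \sum_(l < g) sh_alpha l =
            \sum_(l < g | (l < i)%N) sh_alpha l + sh_alpha i :> H.
    rewrite (bigD1 i) //= addrC; congr (_ + _); apply: eq_bigl => l.
    by have := ltn_ord l; rewrite -val_eqE /=; lia.
  by rewrite addrAC sh_addxx add0r.
- rewrite permE F_sigma; last by have := ltn_ord i; lia.
  have -> : (2 * i.+1 = i.*2.+2)%N by lia.
  rewrite chain_sum_odd chain_sum_even [_ + sh_alpha i]addrC.
  rewrite -[sh_alpha i + _ + _]addrA.
  by rewrite [X in transvection X]addrC sh_addK.
- rewrite permE F_sigma; last by have := ltn_ord j; lia.
  have -> : (2 * i.+1 + 1).-1 = i.*2.+2 by lia.
  have -> : (2 * i.+1 + 1 = j.*2.+1)%N by lia.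
  rewrite chain_sum_even chain_sum_odd.
  have -> : \sum_(l < g | (l < j)%N) sh_alpha l =
            \sum_(l < g | (l < i)%N) sh_alpha l + sh_alpha i :> H.
    rewrite (bigD1 i) /=; last by lia.
    by rewrite addrC; congr (_ + _); apply: eq_bigl => l; rewrite -val_eqE /=; lia.
  by rewrite [X in transvection X]addrACA sh_addxx add0r.
Qed.

Lemma spin_exists (M : 'M['F_2]_(2, g)) :
  exists c : H -> 'F_2, is_spin c /\ spin_matrix c = M.
Proof.
have dotE x y : sh_dot x y = \sum_i (sh_dot x (sh_beta i) * sh_dot y (sh_alpha i) +
                                     sh_dot x (sh_alpha i) * sh_dot y (sh_beta i)).
  have {1}-> : y = sh_extend sh_alpha sh_beta y.
    elim/sh_ind: y => [|y z {1}-> {1}->|i|i].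
    - by rewrite sh_extend0.
    - by rewrite sh_extendD.
    - by rewrite sh_extend_alpha.
    - by rewrite sh_extend_beta.
  rewrite sh_dotC sh_dot_suml; apply: eq_bigr => i _.
  rewrite sh_dotDl !sh_dotZl !(sh_dotC _ x); ring.
pose c x : 'F_2 := \sum_i (sh_dot x (sh_beta i) * M ord0 i +
  sh_dot x (sh_alpha i) * M ord_max i + sh_dot x (sh_beta i) * sh_dot x (sh_alpha i)).
exists c; split=> [x y|].
  rewrite dotE -!big_split; apply: eq_bigr => i _ /=.
  by rewrite !sh_dotDl; ring.
apply/matrixP=> r i; rewrite mxE /c; case: eqP => [->|rN].
  rewrite (bigD1 i) //= big1 => [|j ji]; rewrite sh_alphaP sh_alpha_betaP.
    by rewrite eqxx ?mulr1n; ring.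
  by rewrite eq_sym (negPf ji) ?mulr0n; ring.
have -> : r = ord_max by apply: val_inj; case: r rN => [[|[|//]] ?] // [] //=; apply: val_inj.
rewrite (bigD1 i) //= big1 => [|j ji]; rewrite sh_betaP sh_dotC sh_alpha_betaP.
  by rewrite eqxx ?mulr1n; ring.
by rewrite (negPf ji) ?mulr0n; ring.
Qed.

End Existence.

(* Main.v *)
Require Import Defs.
From mathcomp Require Import all_boot all_order all_algebra all_fingroup.
From mathcomp Require Import zify.

(** The generators [sigma_i] act by the transvections along a chain of cycles
    [gamma_1 = beta_1], [gamma_2 = alpha_1], [gamma_3 = beta_1 + beta_2], ...,
    [gamma_(2g+1) = beta_g], and [T_gamma] fixes a spin structure [c] as soon as
    [c gamma = 1].  For [c = Mbar g m] this holds at every [gamma_i] except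
    [i = g + 1 + 2m].  The permutation [tau] conjugates [sigma_i] to
    [sigma_(2g+2-i)]; a transvection over F_2 determines its vector, so [tau]
    maps [gamma_i] to [gamma_(2g+2-i)].  For [m = 0] the value of [c] on the
    chain is symmetric under this reversal, and the [gamma_i] span. *)

Set Implicit Arguments.
Unset Strict Implicit.
Unset Printing Implicit Defensive.

Import GRing.Theory.

(** * Block sums of permutations: [S_a x S_b] inside [S_(a+b)] *)

Section YoungSubgroup.

Import GroupScope.
Variables a b : nat.

Definition perm_sum_fun (s : 'S_a * 'S_b) (x : 'I_(a + b)) : 'I_(a + b) :=
  match split x with
  | inl i => lshift b (s.1 i)
  | inr j => rshift a (s.2 j)
  end.

Lemma perm_sum_fun_inj s : injective (perm_sum_fun s).
Proof.
apply: (can_inj (g := perm_sum_fun s^-1)) => x; rewrite /perm_sum_fun.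
case: (split_ordP x) => i ->.
  by rewrite (unsplitK (inl _)) permK.
by rewrite (unsplitK (inr _)) permK.
Qed.

Definition perm_sum s : 'S_(a + b) := perm (@perm_sum_fun_inj s).

Lemma perm_suml s i : perm_sum s (lshift b i) = lshift b (s.1 i).
Proof. by rewrite permE /perm_sum_fun (unsplitK (inl _)). Qed.

Lemma perm_sumr s j : perm_sum s (rshift a j) = rshift a (s.2 j).
Proof. by rewrite permE /perm_sum_fun (unsplitK (inr _)). Qed.

Lemma perm_sumM : {in setX [set: 'S_a] [set: 'S_b] &,
  {morph perm_sum : s t / s * t}}.
Proof.
move=> s t _ _; apply/permP=> x; rewrite permM.
by case: (split_ordP x) => i ->; rewrite ?perm_suml ?perm_sumr permM.
Qed.

Canonical perm_sum_morphism := Morphism perm_sumM.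

Lemma injm_perm_sum : 'injm perm_sum.
Proof.
apply/injmP=> s t _ _ st; rewrite [s]surjective_pairing [t]surjective_pairing.
congr (_, _); apply/permP=> i.
  by apply: (@lshift_inj a b); rewrite -!perm_suml st.
by apply: (@rshift_inj a b); rewrite -!perm_sumr st.
Qed.

Lemma perm_sum_tperml i j :
  perm_sum (tperm i j, 1) = tperm (lshift b i) (lshift b j).
Proof.
apply/permP=> x; case: (split_ordP x) => l ->.
  by rewrite perm_suml /= (inj_tperm _ _ _ (@lshift_inj a b)).
by rewrite perm_sumr /= perm1 tpermD // eq_lrshift.
Qed.

Lemma perm_sum_tpermr i j :
  perm_sum (1, tperm i j) = tperm (rshift a i) (rshift a j).
Proof.
apply/permP=> x; case: (split_ordP x) => l ->.
  by rewrite perm_suml /= perm1 tpermD // eq_rlshift.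
by rewrite perm_sumr /= (inj_tperm _ _ _ (@rshift_inj a b)).
Qed.

End YoungSubgroup.

(** * Adjacent transpositions, without the one crossing the cut between points [a - 1] and [a] *)

Definition adjacent_tperms (n a : nat) : {set 'S_n} :=
  [set tperm p.1 p.2 | p : 'I_n * 'I_n & (p.2 == p.1.+1 :> nat) && (p.2 != a :> nat)].

(** Induction on the distance: [(x, y)] is [(x, y-1)] conjugated by [(y-1, y)]. As [x < y] lie on
    the same side of the cut, [y] is not [a], so [(y-1, y)] is a generator. *)
Lemma tperm_gen_adjacent n a (x y : 'I_n) : (x < a) = (y < a) ->
  tperm x y \in (<<adjacent_tperms n a>>)%g.
Proof.
wlog xy : x y / x <= y => [IH xya|].
  by case: (leqP x y) => [|/ltnW] xy; [|rewrite tpermC]; apply: IH.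
have [d] := ubnP (y - x); elim: d x y xy => // d IHd x y xy yx xya.
have [xyE|xyN] := eqVneq (x : nat) y.
  by rewrite (val_inj xyE) tperm1 group1.
have y1n : y.-1 < n by have := ltn_ord y; lia.
pose z := Ordinal y1n; have zy : tperm z y \in (<<adjacent_tperms n a>>)%g.
  by apply/mem_gen/imsetP; exists (z, y) => //; rewrite inE /=; lia.
have [xz|xz] := eqVneq x z; first by rewrite xz.
have <- : (tperm x z ^ tperm z y)%g = tperm x y.
  by rewrite tpermJ tpermL tpermD // eq_sym.
by apply: groupJ zy; apply: IHd => /=; lia.
Qed.

Lemma isog_gen_adjacent n a b : n = a + b ->
  ((<<adjacent_tperms n a>>) \isog setX [set: 'S_a] [set: 'S_b])%g.
Proof.
move=> ->; rewrite isog_sym /=.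
suff <- : (perm_sum_morphism a b @* setX [set: 'S_a] [set: 'S_b] =
  <<adjacent_tperms (a + b) a>>)%g by apply: sub_isog => //; apply: injm_perm_sum.
have sumM s s' (t t' : 'S_b) : perm_sum ((s * s')%g : 'S_a, (t * t')%g) =
    (perm_sum (s, t) * perm_sum (s', t'))%g.
  by rewrite -(morphM (perm_sum_morphism a b)) ?inE.
have sum1 : perm_sum (1%g : 'S_a, 1%g : 'S_b) = 1%g := morph1 (perm_sum_morphism a b).
apply/eqP; rewrite eqEsubset; apply/andP; split.
  apply/subsetP=> _ /morphimP[[s t] _ _ ->] /=.
  (* Each factor is a product of transpositions inside one block, which never cross the cut. *)
  rewrite -[s]mulg1 -[t]mul1g sumM; apply: groupM.
    have [ts -> _] := prod_tpermP s; elim: ts => [|p ts IHts].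
      by rewrite big_nil sum1 group1.
    rewrite big_cons -[X in (_, X)]mulg1 sumM groupM // perm_sum_tperml.
    by rewrite tperm_gen_adjacent //= !ltn_ord.
  have [ts -> _] := prod_tpermP t; elim: ts => [|p ts IHts].
    by rewrite big_nil sum1 group1.
  rewrite big_cons -[X in (X, _)]mulg1 sumM groupM // perm_sum_tpermr.
  by rewrite tperm_gen_adjacent //= !ltnNge !leq_addr.
rewrite gen_subG; apply/subsetP=> _ /imsetP[[x y] + ->]; rewrite inE /=.
(* Consecutive points in different blocks could only be [a - 1] and [a], the omitted pair. *)
case: (split_ordP x) => i ->; case: (split_ordP y) => j -> /=.
- rewrite -perm_sum_tperml => _.
  by apply: (mem_morphim (perm_sum_morphism a b)); rewrite ?inE.
- by have := ltn_ord i; lia.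
- by have := ltn_ord j; lia.
- rewrite -perm_sum_tpermr => _.
  by apply: (mem_morphim (perm_sum_morphism a b)); rewrite ?inE.
Qed.

Lemma frakG_isog g m : m <= g./2 -> (frakG g m \isog
  setX [set: 'S_(g + 1 + 2 * m)] [set: 'S_(g + 1 - 2 * m)])%g.
Proof.
move=> mg; have -> : frakG g m = (<<adjacent_tperms g.*2.+2 (g + 1 + 2 * m)>>)%g.
  congr (<<_>>)%g; apply/setP=> s; apply/imsetP/imsetP=> [[i]|[[x y]]]; rewrite inE.
    move=> /andP[i0 iN] ->; exists (inord i.-1, inord i) => //=.
    by rewrite inE /= !inordK ?iN ?andbT ?prednK //; have := ltn_ord i; lia.
  move=> /andP[/eqP /= xy yN] ->; exists y; first by rewrite inE xy in yN *.
  by rewrite /sigma xy /= -xy !inord_val.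
by apply: isog_gen_adjacent; have := odd_double_half g; lia.
Qed.

Local Open Scope ring_scope.

(** * Entries of the matrices [Mbar], with columns counted from 0 *)

Lemma nth_Ablock i j : nth 0 (Ablock i) j =
  if (j < 2 * i - 1)%N then if odd j then col10 else col11 else 0.
Proof.
case: ltnP => ji; last by rewrite nth_default ?size_mkseq.
by rewrite nth_mkseq //=; case: odd.
Qed.

(* Both the 4k and 4k + 2 shapes, for either parity of m, are the alternating
   pattern 1, 0, 1, 0, ... flipped from column g/2 + m (counted from 0) on. *)
Lemma MbarE g m (r : 'I_2) (j : 'I_g) : (3 < g)%N -> ~~ odd g -> (m <= g./2)%N ->
  Mbar g m r j = if r == ord0 then 1 else (odd j (+) (j < g./2 + m)%N)%:R.
Proof.
move=> g4 go mg; have gE := divn_eq g 4; have gm := ltn_pmod g (isT : 0 < 4)%N.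
have colE (e : bool) : (if e then col10 else col11) r 0 =
    if r == ord0 then 1 else (~~ e)%:R :> 'F_2.
  by case: e; rewrite !mxE; case: (r == _).
suff [e nE eE] : exists2 e : bool, nth 0 (Mbar_cols g m) j = (if e then col10 else col11)
  & e = ~~ (odd j (+) (j < g./2 + m)%N) by rewrite mxE nE colE eE negbK.
exists (~~ (odd j (+) (j < g./2 + m)%N)) => //.
have ge := odd_double_half g; have me := odd_double_half m; have jg := ltn_ord j.
have szA i : size (Ablock i) = (2 * i - 1)%N by rewrite size_mkseq.
have nth10 i : nth 0 [:: col10] i = if (i < 1)%N then col10 else 0.
  by case: i => [|i] /=; rewrite ?nth_nil.
have nth1010 i : nth 0 [:: col10; col10] i = if (i < 2)%N then col10 else 0.
  by case: i => [|[|i]] /=; rewrite ?nth_nil.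
rewrite /Mbar_cols /Mbar_cols4k /Mbar_cols4k2.
do 3?[case: ifP => ?]; rewrite !nth_cat !szA /= ?nth10 ?nth1010 !nth_Ablock.
(* Branches reaching the default column 0 are contradictory, since [j < g]. *)
all: repeat (case: ifP => ?); try reflexivity; exfalso; lia.
Qed.

(** * Transvections, spin structures and the chain of cycles *)

Section Isotropy.

Context {g : nat} {H : surface_homology g}.
Implicit Types (x y z gamma : H) (c : H -> 'F_2).

Lemma sh_dotxx x : sh_dot x x = 0.
Proof.
elim/(@sh_ind g H): x => [|x y xx yy|i|i]; rewrite ?sh_dot0l ?sh_alphaP ?sh_betaP //.
by rewrite sh_dotDl !sh_dotDr xx yy add0r addr0 (sh_dotC y) addF2.
Qed.

Lemma sh_extend_id x : sh_extend sh_alpha sh_beta x = x.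
Proof.
elim/(@sh_ind g H): x => [|x y xE yE|i|i].
- exact: sh_extend0.
- by rewrite sh_extendD xE yE.
- exact: sh_extend_alpha.
- exact: sh_extend_beta.
Qed.

(** The coordinates of [x] in the symplectic basis are its intersection numbers with basis
    elements. *)
Lemma sh_dot_nondegenerate x : (forall y, sh_dot y x = 0) -> x = 0.
Proof.
move=> x0; rewrite -[x]sh_extend_id; apply: big1 => i _.
by rewrite !(sh_dotC x) !x0 !scale0r addr0.
Qed.

(** A transvection displaces each point by 0 or by its vector, so a nonzero vector is read off from
    any moved point. *)
Lemma transvection_inj gamma delta :
  transvection gamma =1 transvection delta -> gamma = delta.
Proof.
move=> E; have {}E x : sh_dot x gamma *: gamma = sh_dot x delta *: delta.
  exact: (addrI x) (E x).
have [/existsP[x /eqP xg]|] := boolP [exists x : H, sh_dot x gamma == 1].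
  have := E x; rewrite xg scale1r; case: (F2_cases (sh_dot x delta)) => ->.
    by rewrite scale0r => g0; move: xg; rewrite g0 sh_dotC sh_dot0l.
  by rewrite scale1r.
move=> /existsPn gN; have g0 : gamma = 0.
  apply: sh_dot_nondegenerate => x; have := gN x.
  by case: (F2_cases (sh_dot x gamma)) => ->.
rewrite g0; apply/esym/sh_dot_nondegenerate => x; have := E x.
(* A pairing equal to 1 would force [delta = 0], hence a pairing equal to 0. *)
rewrite g0 scaler0; case: (F2_cases (sh_dot x delta)) => xd; rewrite xd // scale1r -xd.
by move=> <-; rewrite sh_dotC sh_dot0l.
Qed.

(** When [x] is moved, [c gamma] and the intersection number are both 1 and cancel. *)
Lemma spin_transvection c gamma x :
  is_spin c -> c gamma = 1 -> c (transvection gamma x) = c x.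
Proof.
move=> cS cg; rewrite /transvection.
case: (F2_cases (sh_dot x gamma)) => xg; rewrite xg ?scale0r ?addr0 //.
by rewrite scale1r cS cg xg -addrA addF2 addr0.
Qed.

(** The cycle [gamma_i], as the difference (mod 2, the sum) of consecutive partial sums of the
    chain; this form makes sums of cycles telescope. *)
Definition chain_cycle (i : nat) : H :=
  chain_sum sh_alpha sh_beta i.-1 + chain_sum sh_alpha sh_beta i.

Lemma chain_cycle_first (i : 'I_g) : i = 0%N :> nat -> chain_cycle 1 = sh_beta i.
Proof.
move=> i0; rewrite /chain_cycle chain_sum0 add0r.
have -> : chain_sum sh_alpha sh_beta 1 = chain_sum sh_alpha sh_beta i.*2.+1 :> H.
  by rewrite i0.
by rewrite chain_sum_odd big_pred0 ?add0r // => l; rewrite i0.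
Qed.

Lemma chain_cycle_last (i : 'I_g) : i.+1 = g -> chain_cycle (2 * g + 1) = sh_beta i.
Proof.
move=> ig; rewrite /chain_cycle.
have -> : (2 * g + 1).-1 = i.*2.+2 by lia.
have -> : (2 * g + 1 = g.*2.+1)%N by lia.
rewrite chain_sum_even chain_sum_last.
have -> : \sum_(l < g) sh_alpha l =
          \sum_(l < g | (l < i)%N) sh_alpha l + sh_alpha i :> H.
  rewrite (bigD1 i) //= addrC; congr (_ + _); apply: eq_bigl => l.
  by have := ltn_ord l; rewrite -val_eqE /=; lia.
by rewrite addrAC sh_addxx add0r.
Qed.

Lemma chain_cycle_even (i : 'I_g) : chain_cycle (2 * i.+1) = sh_alpha i.
Proof.
rewrite /chain_cycle; have -> : (2 * i.+1 = i.*2.+2)%N by lia.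
rewrite chain_sum_odd chain_sum_even [_ + sh_alpha i]addrC.
by rewrite -[sh_alpha i + _ + _]addrA [LHS]addrC sh_addK.
Qed.

Lemma chain_cycle_odd (i j : 'I_g) : j = i.+1 :> nat ->
  chain_cycle (2 * i.+1 + 1) = sh_beta i + sh_beta j.
Proof.
move=> ji; rewrite /chain_cycle.
have -> : (2 * i.+1 + 1).-1 = i.*2.+2 by lia.
have -> : (2 * i.+1 + 1 = j.*2.+1)%N by lia.
rewrite chain_sum_even chain_sum_odd.
have -> : \sum_(l < g | (l < j)%N) sh_alpha l =
          \sum_(l < g | (l < i)%N) sh_alpha l + sh_alpha i :> H.
  rewrite (bigD1 i) /=; last by lia.
  by rewrite addrC; congr (_ + _); apply: eq_bigl => l; rewrite -val_eqE /=; lia.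
by rewrite addrACA sh_addxx add0r.
Qed.

(** The cases match the clauses of [is_iota] that prescribe the images of the generators. *)
Lemma sigma_indexP i : (0 < g)%N -> (0 < i < g.*2.+2)%N ->
  [\/ i = 1%N, i = (2 * g + 1)%N, exists j : 'I_g, i = (2 * j.+1)%N
    | exists j l : 'I_g, l = j.+1 :> nat /\ i = (2 * j.+1 + 1)%N].
Proof.
move=> g0 /andP[i0 ig]; have := odd_double_half i.
case: (eqVneq i 1%N) => [->|i1]; first by constructor 1.
case: (eqVneq i (2 * g + 1)%N) => [->|iN]; first by constructor 2.
case: (boolP (odd i)) => io iE.
  have jg : (i./2.-1 < g)%N by lia.
  have lg : (i./2 < g)%N by lia.
  by constructor 4; exists (Ordinal jg), (Ordinal lg) => /=; lia.
have jg : (i./2.-1 < g)%N by lia.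
by constructor 3; exists (Ordinal jg) => /=; lia.
Qed.

(** The cycles generate [H]: their sums telescope to the partial sums of the chain, which already
    generate. *)
Lemma sh_ind_cycle (P : H -> Prop) : (0 < g)%N ->
  (forall x y, P x -> P y -> P (x + y)) ->
  (forall i, (0 < i < g.*2.+2)%N -> P (chain_cycle i)) -> forall x, P x.
Proof.
move=> g0 PD Pc; have P0 : P 0.
  by rewrite -(sh_addxx (chain_cycle 1)); apply: PD; apply: Pc.
apply: sh_ind_chain => //; elim=> [_|j IHj jg]; first by rewrite chain_sum0.
have -> : chain_sum sh_alpha sh_beta j.+1 =
    chain_cycle j.+1 + chain_sum sh_alpha sh_beta j :> H.
  by rewrite addrC addrA sh_addxx add0r.
by apply: PD; [apply: Pc | apply: IHj; lia].
Qed.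

Lemma spin_eq_on_cycles c c' : (0 < g)%N -> is_spin c -> is_spin c' ->
  (forall i, (0 < i < g.*2.+2)%N -> c (chain_cycle i) = c' (chain_cycle i)) ->
  c =1 c'.
Proof.
move=> g0 cS cS' cc; apply: sh_ind_cycle => // x y xE yE.
by rewrite cS cS' xE yE.
Qed.

(** * The action of the symmetric group on cycles and spin structures *)

Context (iota : {morphism [set: 'S_(g.*2.+2)]%g >-> {perm H}}).
Hypothesis iotaP : is_iota iota.
Hypothesis g0 : (0 < g)%N.

Lemma iota_sigma i : (0 < i < g.*2.+2)%N ->
  iota (sigma g i) =1 transvection (chain_cycle i).
Proof.
have [_ first_ last_ even_ odd_] := iotaP.
move=> /(sigma_indexP g0)[->|->|[j ->]|[j [l [lj ->]]]].
- by rewrite (@chain_cycle_first (Ordinal g0)) //; apply: first_.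
- have jg : (g.-1 < g)%N by lia.
  have jE : (Ordinal jg).+1 = g by rewrite /= prednK.
  by rewrite (chain_cycle_last jE); apply: last_.
- by rewrite chain_cycle_even; apply: even_.
- by rewrite (chain_cycle_odd lj); apply: odd_.
Qed.

Lemma iota_Sp s : [/\ forall x y, iota s (x + y) = iota s x + iota s y,
  forall e x, iota s (e *: x) = e *: iota s x
  & forall x y, sh_dot (iota s x) (iota s y) = sh_dot x y].
Proof.
have [/subsetP/(_ (iota s)) sSp _ _ _ _] := iotaP.
have {sSp} := sSp (mem_morphim _ (in_setT s) (in_setT s)).
rewrite inE => /andP[/forallP sL /'forall_forallP sD].
have lin e x y : iota s (e *: x + y) = e *: iota s x + iota s y.
  by have /forallP/(_ x)/forallP/(_ y)/eqP := sL e.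
have D x y : iota s (x + y) = iota s x + iota s y.
  by have := lin 1 x y; rewrite !scale1r.
have s0 : iota s 0 = 0 by apply: (addrI (iota s 0)); rewrite -D !addr0.
split=> [//|e x|x y]; last exact/eqP.
by rewrite -[e *: x]addr0 lin s0 addr0.
Qed.

Lemma spin_act_spin c s : is_spin c -> is_spin (spin_act iota c s).
Proof.
have [sD _ sdot] := iota_Sp s.
by move=> cS x y; rewrite /spin_act /= sD cS sdot.
Qed.

Lemma sigma_isotropy c i : is_spin c -> (0 < i < g.*2.+2)%N ->
  c (chain_cycle i) = 1 -> sigma g i \in isotropy iota c.
Proof.
move=> cS ig ci; rewrite inE; apply/forallP=> x; apply/eqP.
by rewrite /spin_act /= iota_sigma // spin_transvection.
Qed.

(** Conjugating a transvection by the isometry [iota s] gives the transvection along the image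
    vector, and the transvection determines that vector. *)
Lemma iota_conj_cycle s i j : (0 < i < g.*2.+2)%N -> (0 < j < g.*2.+2)%N ->
  (sigma g i ^ s)%g = sigma g j -> iota s (chain_cycle i) = chain_cycle j.
Proof.
move=> ig jg ij; have [sD sZ sdot] := iota_Sp s.
apply: transvection_inj => x; rewrite -iota_sigma // -ij morphJ ?inE //.
rewrite -[x](permKV (iota s)) permJ iota_sigma // /transvection.
by rewrite [RHS]sD sZ sdot.
Qed.

End Isotropy.

(** * The reversal [tau] *)

Lemma tau_inord g p : (p < g.*2.+2)%N -> tau g (inord p) = inord (g.*2.+1 - p).
Proof.
(* The first [n] factors reflect exactly the [n] outermost points at each end; [n = g + 1] covers
   all points. *)
move=> pg; suff tauE n : (n <= g.+1)%N ->
    (\prod_(i < n) tperm (inord i : 'I_g.*2.+2) (inord (g.*2.+1 - i)))%g (inord p) =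
    if (p < n)%N || (g.*2.+1 - n < p)%N then inord (g.*2.+1 - p) else inord p.
  by rewrite /tau tauE //; case: ifP => //; lia.
elim: n => [_|n IHn ng].
  by rewrite big_ord0 perm1; case: ifP => //; lia.
rewrite big_ord_recr /= permM IHn; last by lia.
have inordE i j : (i < g.*2.+2)%N -> (j < g.*2.+2)%N ->
    (inord i == inord j :> 'I_g.*2.+2) = (i == j) by move=> *; rewrite -val_eqE /= !inordK.
case: ifP => pn.
  rewrite tpermD; first by case: ifP => //; lia.
    by rewrite inordE; lia.
  by rewrite inordE; lia.
case: tpermP => [/eqP|/eqP|/eqP + /eqP]; rewrite !inordE; try by lia.
- by move=> /eqP ->; rewrite leqnn.
- move=> /eqP pE; rewrite ifT; [congr inord|]; lia.
- by move=> p1 p2; rewrite ifF //; lia.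
Qed.

Lemma tau_conj_sigma g i : (0 < i < g.*2.+2)%N ->
  (sigma g i ^ tau g)%g = sigma g (g.*2.+2 - i).
Proof.
move=> ig; rewrite /sigma tpermJ !tau_inord; try lia.
by rewrite tpermC; congr tperm; congr inord; lia.
Qed.

(** The top row is constantly 1, and adjacent bottom entries differ except across the flip at column
    [g/2 + m], which corresponds to the excluded index. *)
Lemma Mbar_chain_cycle g (H : surface_homology g) (c : H -> 'F_2) m i :
    (3 < g)%N -> ~~ odd g -> (m <= g./2)%N -> is_spin c -> spin_matrix c = Mbar g m ->
    (0 < i < g.*2.+2)%N -> i != (g + 1 + 2 * m)%N ->
  c (chain_cycle i) = 1.
Proof.
move=> g4 go mg cS /matrixP cM ig iN; have ge := odd_double_half g.
have ca j : c (sh_alpha j) = 1 by have := cM ord0 j; rewrite mxE MbarE.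
have cb j : c (sh_beta j) = (odd j (+) (j < g./2 + m)%N)%:R.
  by have := cM ord_max j; rewrite mxE MbarE.
have g0 : (0 < g)%N by lia.
move: iN; case: (sigma_indexP g0 ig) => [->|->|[j ->]|[j [l [lj ->]]]] iN.
- by rewrite (@chain_cycle_first _ _ (Ordinal g0)) // cb /=; have -> : (0 < g./2 + m)%N by lia.
- have jg : (g.-1 < g)%N by lia.
  have jE : (Ordinal jg).+1 = g by rewrite /= prednK.
  rewrite (chain_cycle_last jE) cb /=.
  (* For [m = g/2] this last cycle is the excluded one; otherwise the odd column [g - 1] lies past
     the flip. *)
  by have -> : odd g.-1 (+) (g.-1 < g./2 + m)%N by lia.
- by rewrite chain_cycle_even.
- rewrite (chain_cycle_odd lj) cS sh_betaP addr0 !cb lj /=.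
  (* The excluded index is exactly the case [j + 1 = g/2 + m]. *)
  have : (j.+1 < g./2 + m)%N = (j < g./2 + m)%N by lia.
  by move=> ->; case: odd; case: leq; apply/val_inj.
Qed.

Local Close Scope ring_scope.

Theorem theorem4p5 (k g : nat) (hk : 1 <= k)
    (hg : g = 4 * k \/ g = 4 * k + 2)
    (H : surface_homology g)
    (iota : {morphism [set: 'S_(g.*2.+2)]%g >-> {perm H}})
    (hiota : is_iota iota) :
  (forall m : nat, 1 <= m <= g./2 ->
     (frakG g m \isog
        setX [set: 'S_(g + 1 + 2 * m)] [set: 'S_(g + 1 - 2 * m)])%g /\
     (forall c : H -> 'F_2, is_spin c -> spin_matrix c = Mbar g m ->
        frakG g m \subset isotropy iota c)) /\
  (forall c : H -> 'F_2, is_spin c -> spin_matrix c = Mbar g 0 ->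
     frakG0 g \subset isotropy iota c).
Proof.
have g4 : (3 < g)%N by lia.
have go : ~~ odd g by lia.
have g0 : (0 < g)%N by lia.
split=> [m /andP[m1 mg]|c cS cM].
  split=> [|c cS cM]; first exact: frakG_isog.
  rewrite gen_subG; apply/subsetP=> _ /imsetP[i + ->]; rewrite inE => /andP[i0 iN].
  apply: sigma_isotropy => //; first by rewrite i0 /=.
  by apply: (Mbar_chain_cycle g4 go mg cS cM); rewrite ?i0 /=.
have cC i : (0 < i < g.*2.+2)%N -> i != (g + 1)%N -> c (chain_cycle i) = 1%R.
  by move=> ig iN; apply: (Mbar_chain_cycle g4 go _ cS cM); rewrite ?muln0 ?addn0.
rewrite gen_subG; apply/subsetP=> s /setU1P[->|].
  rewrite inE; apply/forallP=> x; apply/eqP; move: x.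
  apply: spin_eq_on_cycles => //; first exact: spin_act_spin.
  move=> i ig; have jg : (0 < g.*2.+2 - i < g.*2.+2)%N by lia.
  rewrite /spin_act /= (iota_conj_cycle hiota g0 ig jg (tau_conj_sigma ig)).
  (* The reversal fixes the middle index [g + 1], the only one where [c] is not known to be 1. *)
  have [->|iN] := eqVneq i (g + 1)%N; first by congr (c (chain_cycle _)); lia.
  by rewrite !cC //; lia.
move=> /imsetP[i + ->]; rewrite inE => /andP[i0 iN].
by apply: sigma_isotropy => //; rewrite ?cC ?i0 /=.
Qed.
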